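(* Let $r\geq 2$ be an integer, let $G$ be a finite simple undirected $r$-regular graph, and let $\varphi$ be an edge labeling of $G$. Then $$|V_{int}(G,\varphi)|\leq\left\lfloor\frac{r\cdot|V(G)|-2\cdot\eta(G[V_{int}(G,\varphi)])}{2\cdot(r-1)}\right\rfloor.$$
   Context: An interval is a nonempty finite set of consecutive integers. An edge labeling of a graph $G$ is an injective function $\varphi:E(G)\to\{1,2,\dots,|E(G)|\}$ (equivalently a bijection). For a vertex $x$, its spectrum is $S_G(x,\varphi)=\{\varphi(e): e\in E(G),\ e \text{ incident with } x\}$, and $V_{int}(G,\varphi)=\{x\in V(G): S_G(x,\varphi)\text{ is an interval}\}$. For $V_0\subseteq V(G)$, $G[V_0]$ is the subgraph induced by $V_0$. For a graph $H$, $\eta(H)=0$ if $H$ has no vertices, and otherwise $\eta(H)$ is the number of connected components of $H$. *)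

(* Defs.v *)
From HB Require Import structures.
From mathcomp Require Import all_boot all_order all_algebra.

Set Implicit Arguments.
Unset Strict Implicit.
Unset Printing Implicit Defensive.

Record sgraph := SGraph {
  vertex :> finType;
  adj : rel vertex;
  adj_sym : symmetric adj;
  adj_irr : irreflexive adj }.

Definition edges (G : sgraph) : {set {set G}} :=
  [set [set p.1; p.2] | p : G * G & adj p.1 p.2].

Definition regular (G : sgraph) (r : nat) : Prop :=
  forall x : G, #|[set y | adj x y]| = r.

(* The values of phi outside [edges G] are irrelevant. *)
Definition edge_labeling (G : sgraph) (phi : {set G} -> nat) : Prop :=
  {in edges G &, injective phi} /\
  {in edges G, forall f, 0 < phi f <= #|edges G|}.

(* The spectrum is a finite set of integers, represented by a list which is
   only ever used through membership. *)
Definition spectrum (G : sgraph) (phi : {set G} -> nat) (x : G) : seq nat :=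
  [seq phi f | f in [set f in edges G | x \in f]].

(* Decidable form of: some a <= b satisfy s = {a, a+1, ..., b}; the endpoints
   are looked for in s itself. See [is_intervalP]. *)
Definition is_interval (s : seq nat) : bool :=
  has (fun a => has (fun b =>
    [&& a <= b, all [in index_iota a b.+1] s & all [in s] (index_iota a b.+1)])
  s) s.

Lemma is_intervalP (s : seq nat) :
  reflect (exists a b, a <= b /\ forall k, (k \in s) = (a <= k <= b))
          (is_interval s).
Proof.
apply: (iffP hasP) => [[a as_ /hasP[b bs /and3P[ab /allP s1 /allP s2]]]|].
  exists a, b; split=> // k; apply/idP/idP => [/s1|kab].
    by rewrite /= mem_index_iota ltnS.
  by apply: s2; rewrite mem_index_iota ltnS.
case=> a [b [ab sE]]; exists a; first by rewrite sE leqnn ab.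
apply/hasP; exists b; first by rewrite sE leqnn ab.
by rewrite ab /=; apply/andP; split; apply/allP => k;
  rewrite /= mem_index_iota ltnS sE.
Qed.

Definition Vint (G : sgraph) (phi : {set G} -> nat) : {set G} :=
  [set x | is_interval (spectrum phi x)].

Definition induced_adj (G : sgraph) (V0 : {set G}) : rel {x : G | x \in V0} :=
  fun u v => adj (val u) (val v).

Fact induced_sym (G : sgraph) (V0 : {set G}) : symmetric (@induced_adj G V0).
Proof. by move=> u v; apply: adj_sym. Qed.

Fact induced_irr (G : sgraph) (V0 : {set G}) : irreflexive (@induced_adj G V0).
Proof. by move=> u; apply: adj_irr. Qed.

Definition induced (G : sgraph) (V0 : {set G}) : sgraph :=
  SGraph (@induced_sym G V0) (@induced_irr G V0).

Definition num_components (H : sgraph) : nat := n_comp (@adj H) H.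

Lemma num_components_no_vertices (H : sgraph) : #|H| = 0 -> num_components H = 0.
Proof.
move=> H0; apply/eqP; rewrite -leqn0 -H0; apply: subset_leq_card.
by apply/subsetP => x _.
Qed.

Lemma spectrumP (G : sgraph) (phi : {set G} -> nat) (x : G) (k : nat) :
  reflect (exists2 f, f \in edges G /\ x \in f & k = phi f)
          (k \in spectrum phi x).
Proof.
by apply: (iffP imageP) => -[f]; [rewrite inE => /andP[]|case] => fE xf ->;
  exists f => //; rewrite inE fE.
Qed.

(* Main.v *)
Require Import Defs.
From HB Require Import structures.
From mathcomp Require Import all_boot all_order all_algebra.
From mathcomp Require Import lra.
Set Implicit Arguments.
Unset Strict Implicit.
Unset Printing Implicit Defensive.
Import Order.TTheory GRing.Theory Num.Theory.

(** Say that an edge [f] is followed at [x] if both [phi f] and [phi f + 1] are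
    labels of edges at [x]. An edge is followed at no more than one of its ends,
    because two distinct edges share at most one vertex. At an interval vertex
    every edge but the one with the largest label is followed. Finally, for each
    component of [G[V0]], the edge of largest label among those meeting the
    component is followed at no vertex of [V0], and these edges are distinct
    since an edge cannot meet two components. Counting the edges of [G] gives
    [\sum_(x in Vint) (deg x - 1) + eta(G[Vint]) <= |E|]. *)

Lemma leq_n_comp_card (T U : finType) (e : rel T) (f : T -> U) (B : {set U}) :
    connect_sym e -> (forall z, f z \in B) ->
    (forall z w, f z = f w -> connect e z w) ->
  n_comp e T <= #|B|.
Proof.
move=> e_sym fB f_connect.
have f_inj : {in [predI roots e & T] &, injective f}.
  move=> z w /andP[/eqP z_root _] /andP[/eqP w_root _] eq_fzw.
  by rewrite -z_root -w_root; apply/(fingraph.rootP e_sym)/f_connect.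
rewrite /n_comp_mem -(card_in_imset f_inj).
by apply/subset_leq_card/subsetP => _ /imsetP[z _ ->].
Qed.

Lemma card_bigcup_disjoint (I T : finType) (A : {set I}) (F : I -> {set T}) :
    {in A &, forall i j, i != j -> [disjoint F i & F j]} ->
  #|\bigcup_(i in A) F i| = \sum_(i in A) #|F i|.
Proof.
move=> F_disjoint; rewrite big_mkcond -sum1_card partition_disjoint_bigcup.
  rewrite [RHS]big_mkcond; apply: eq_bigr => i _; rewrite sum1_card.
  by case: ifP => // _; exact: cards0.
move=> i j; case: ifP => [iA|_ _]; last by rewrite -setI_eq0 set0I.
case: ifP => [jA|_ _]; last by rewrite -setI_eq0 setI0.
exact: F_disjoint.
Qed.

Section Incidence.

Variable G : sgraph.
Implicit Types (x y : G) (f : {set G}).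

Lemma adj_connect_sym : connect_sym (@adj G).
Proof. exact/sym_connect_sym/adj_sym. Qed.

Definition incident x : {set {set G}} := [set f in edges G | x \in f].

Lemma incident_edge x f : f \in incident x -> f \in edges G.
Proof. by case/setIdP. Qed.

Lemma incidentP x f :
  reflect (exists2 y, adj x y & f = [set x; y]) (f \in incident x).
Proof.
apply: (iffP setIdP) => [[/imsetP[[u v]]]|[y xy ->]]; last first.
  by rewrite set21; split=> //; apply/imsetP; exists (x, y); rewrite ?inE.
rewrite inE /= => uv -> /set2P[]->; first by exists v.
by exists u; rewrite 1?adj_sym // setUC.
Qed.

Lemma incident_pair x y f : x != y -> f \in incident x -> f \in incident y ->
  adj x y /\ f = [set x; y].
Proof.
move=> neq_xy /incidentP[z xz ->] /setIdP[_ /set2P[eq_yx|->//]].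
by rewrite eq_yx eqxx in neq_xy.
Qed.

Lemma card_incident x : #|incident x| = #|[set y | adj x y]|.
Proof.
have -> : incident x = [set [set x; y] | y in [set y | adj x y]].
  by apply/setP=> f; apply/incidentP/imsetP => -[y xy ->]; exists y;
    rewrite ?inE in xy *.
apply: card_in_imset => y z; rewrite !inE => xy xz eq_yz.
have /set2P[yx|//] : y \in [set x; z] by rewrite -eq_yz set22.
by rewrite yx adj_irr in xy.
Qed.

Lemma card_edge f : f \in edges G -> #|f| = 2.
Proof.
move=> /imsetP[[x y]]; rewrite inE /= => xy ->; rewrite cards2.
by case: eqP xy => [->|//]; rewrite adj_irr.
Qed.

Lemma sum_card_incident : \sum_(x : G) #|incident x| = 2 * #|edges G|.
Proof.
under eq_bigr => x _ do rewrite -sum1dep_card.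
rewrite (exchange_big_dep (mem (edges G))) /= => [|x f _ /andP[]//].
rewrite mulnC -sum_nat_const; apply: eq_bigr => f fE.
rewrite sum1dep_card -[RHS](card_edge fE).
by apply: eq_card => x; rewrite !inE fE.
Qed.

End Incidence.

Section Labeling.

Variables (G : sgraph) (phi : {set G} -> nat).
Hypothesis phi_inj : {in edges G &, injective phi}.
Implicit Types (x y : G) (f : {set G}).

Definition followed x : {set {set G}} :=
  [set f in incident x | (phi f).+1 \in spectrum phi x].

Lemma mem_spectrum x f : f \in incident x -> phi f \in spectrum phi x.
Proof. by case/setIdP=> fE xf; apply/spectrumP; exists f. Qed.

Lemma followedP x f :
  reflect (f \in incident x /\ exists2 g, g \in incident x & phi g = (phi f).+1)
          (f \in followed x).
Proof.
apply: (iffP setIdP) => -[fx]; last by case=> g /mem_spectrum gx <-.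
by case/spectrumP=> g [gE xg] ->; split=> //; exists g; rewrite // inE gE.
Qed.

Lemma followed_disjoint x y : x != y -> [disjoint followed x & followed y].
Proof.
move=> neq_xy; apply/pred0Pn => -[f /andP[]].
move=> /followedP[fx [g gx phi_g]] /followedP[fy [h hy phi_h]].
have eq_gh : g = h.
  apply: phi_inj (incident_edge gx) (incident_edge hy) _.
  by rewrite phi_g phi_h.
have eq_fg : f = g.
  have [_ ->] := incident_pair neq_xy fx fy.
  by rewrite eq_gh in gx *; have [_ ->] := incident_pair neq_xy gx hy.
by move: phi_g; rewrite eq_fg => /n_Sn.
Qed.

Lemma card_followed_Vint x :
  x \in Vint phi -> #|incident x| = #|followed x|.+1.
Proof.
rewrite inE => /is_intervalP[a [b [le_ab spectrumE]]].
have /spectrumP[t [tE xt] b_def] : b \in spectrum phi x.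
  by rewrite spectrumE le_ab leqnn.
have t_inc : t \in incident x by rewrite inE tE.
suff -> : followed x = incident x :\ t by rewrite (cardsD1 t) t_inc.
apply/setP => f; rewrite in_setD1 andbC inE; apply: andb_id2l => fx.
have := mem_spectrum fx; rewrite !spectrumE b_def => /andP[le_af le_ft].
rewrite leqW //= ltn_neqAle le_ft andbT; congr (~~ _).
by apply/eqP/eqP => [|->//]; apply: phi_inj (incident_edge fx) tE.
Qed.

Lemma incident_Vint_neq0 x : x \in Vint phi -> incident x != set0.
Proof. by move=> /card_followed_Vint card_x; rewrite -card_gt0 card_x. Qed.

Section InducedComponents.

Variable V0 : {set G}.
Hypothesis V0_incident : {in V0, forall x, incident x != set0}.

Let H := induced V0.
Implicit Types (z w : H).

Definition component_edges z : {set {set G}} :=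
  \bigcup_(u : H | connect (@adj H) z u) incident (val u).

Lemma component_edges_connect z w f :
  f \in component_edges z -> f \in component_edges w -> connect (@adj H) z w.
Proof.
move=> /bigcupP[u zu fu] /bigcupP[v wv fv].
apply: connect_trans zu _; rewrite adj_connect_sym.
apply: connect_trans wv _; have [->|neq_vu] := eqVneq v u.
  exact: connect0.
by apply: connect1; have [] := @incident_pair G _ _ f neq_vu fv fu.
Qed.

Lemma exists_unfollowed_component_edge z :
  exists2 f, f \in component_edges z
           & f \in edges G :\: \bigcup_(x in V0) followed x.
Proof.
have /set0Pn[f0 f0z] := V0_incident (valP z).
have f0C : f0 \in component_edges z by apply/bigcupP; exists z.
case: (arg_maxnP phi f0C) => f fC f_max; exists f => //.
have /bigcupP[u zu fu] := fC; rewrite inE (incident_edge fu) andbT.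
apply/bigcupP => -[y yV /followedP[fy [g gy phi_g]]].
have y_edges h : h \in incident y -> h \in component_edges (Sub y yV).
  by move=> hy; apply/bigcupP; exists (Sub y yV); rewrite ?SubK.
have zy := component_edges_connect fC (y_edges f fy).
have gC : g \in component_edges z by apply/bigcupP; exists (Sub y yV).
by have := f_max g gC; rewrite phi_g /= ltnn.
Qed.

Lemma leq_num_components_unfollowed :
  num_components H <= #|edges G :\: \bigcup_(x in V0) followed x|.
Proof.
have /fin_all_exists2[f fC f_unfollowed] := exists_unfollowed_component_edge.
apply: (leq_n_comp_card (@adj_connect_sym H) f_unfollowed) => z w eq_f.
by apply: component_edges_connect (fC z) _; rewrite eq_f.
Qed.

Lemma leq_sum_followed_components :
  \sum_(x in V0) #|followed x| + num_components H <= #|edges G|.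
Proof.
rewrite -card_bigcup_disjoint => [|x y _ _]; last exact: followed_disjoint.
rewrite -(cardsID (\bigcup_(x in V0) followed x) (edges G)).
apply: leq_add leq_num_components_unfollowed.
rewrite (setIidPr _) //; apply/bigcupsP => x _; apply/subsetP => f.
by case/followedP => /incident_edge.
Qed.

End InducedComponents.

Lemma leq_sum_Vint_components :
  \sum_(x in Vint phi) #|incident x|.-1 + num_components (induced (Vint phi))
    <= #|edges G|.
Proof.
under eq_bigr => x xV do rewrite (card_followed_Vint xV).
exact: leq_sum_followed_components incident_Vint_neq0.
Qed.

Lemma leq_card_Vint_regular r : regular G r ->
  2 * (#|Vint phi| * r.-1 + num_components (induced (Vint phi))) <= r * #|G|.
Proof.
move=> G_reg; have deg_r x : #|incident x| = r by rewrite card_incident.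
have := leq_sum_Vint_components; under eq_bigr do rewrite deg_r.
have := sum_card_incident G; under eq_bigr do rewrite deg_r.
by rewrite !sum_nat_const mulnC => ->; rewrite leq_mul2l.
Qed.

End Labeling.

Local Open Scope ring_scope.

Theorem theorem2 (r : nat) (G : sgraph) (phi : {set G} -> nat)
    (hr : (2 <= r)%N) (hG : regular G r) (hphi : edge_labeling phi) :
  (#|Vint phi|)%:Z <=
    Num.floor ((r%:R * #|G|%:R - 2 * (num_components (induced (Vint phi)))%:R)
                 / (2 * (r%:R - 1)) : rat).
Proof.
have [phi_inj _] := hphi.
have := leq_card_Vint_regular phi_inj hG.
rewrite -(ler_nat rat) !(natrM, natrD) -subn1 natrB ?(ltnW hr) // => bound.
have r_gt1 : 1 < r%:R :> rat by rewrite ltr1n.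
rewrite floor_ge_int ler_pdivlMr -?pmulrn; lra.
Qed.
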